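(* For any derivation of a sequent $S \mid \Gamma \vdash C$ in the skew monoidal sequent calculus, there is a focused derivation of $S \mid \Gamma \vdash_{\mathsf L} C$.
   Context: Fix a set $\mathrm{Var}$ of atoms. Formulae: atoms $X \in \mathrm{Var}$, $\mathsf{I}$, and $A \otimes B$ for formulae $A, B$. A context is a finite list of formulae; a stoup $S$ is either empty (written $-$) or a single formula; a stoup $T$ is irreducible if $T = -$ or $T$ is an atom. Skew monoidal sequent calculus: sequents $S \mid \Gamma \vdash C$ derived by (ax) $A \mid\ \vdash A$; (pass) from $A \mid \Gamma \vdash C$ infer $- \mid A, \Gamma \vdash C$; (scut) from $S \mid \Gamma \vdash A$ and $A \mid \Delta \vdash C$ infer $S \mid \Gamma, \Delta \vdash C$; (ccut) from $- \mid \Gamma \vdash A$ and $S \mid \Delta_0, A, \Delta_1 \vdash C$ infer $S \mid \Delta_0, \Gamma, \Delta_1 \vdash C$; ($\mathsf I$L) from $- \mid \Gamma \vdash C$ infer $\mathsf I \mid \Gamma \vdash C$; ($\mathsf I$R) $- \mid\ \vdash \mathsf I$; ($\otimes$L) from $A \mid B, \Gamma \vdash C$ infer $A \otimes B \mid \Gamma \vdash C$; ($\otimes$R) from $S \mid \Gamma \vdash A$ and $- \mid \Delta \vdash B$ infer $S \mid \Gamma, \Delta \vdash A \otimes B$. Focused calculus: sequents $S \mid \Gamma \vdash_{\mathsf L} C$ and $T \mid \Gamma \vdash_{\mathsf R} C$ ($T$ irreducible), derived by: (pass) from $A \mid \Gamma \vdash_{\mathsf L} C$ infer $- \mid A, \Gamma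 \vdash_{\mathsf L} C$; (switch) from $T \mid \Gamma \vdash_{\mathsf R} C$ infer $T \mid \Gamma \vdash_{\mathsf L} C$; (ax) $X \mid\ \vdash_{\mathsf R} X$ for atoms $X$; ($\mathsf I$L) from $- \mid \Gamma \vdash_{\mathsf L} C$ infer $\mathsf I \mid \Gamma \vdash_{\mathsf L} C$; ($\mathsf I$R) $- \mid\ \vdash_{\mathsf R} \mathsf I$; ($\otimes$L) from $A \mid B, \Gamma \vdash_{\mathsf L} C$ infer $A \otimes B \mid \Gamma \vdash_{\mathsf L} C$; ($\otimes$R) from $T \mid \Gamma \vdash_{\mathsf R} A$ and $- \mid \Delta \vdash_{\mathsf L} B$ infer $T \mid \Gamma, \Delta \vdash_{\mathsf R} A \otimes B$. *)

(* Defs.v *)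
From Stdlib Require Import List.
Import ListNotations.

Set Implicit Arguments.

Inductive fma (Var : Type) : Type :=
| Atom : Var -> fma Var
| Unit : fma Var
| Tensor : fma Var -> fma Var -> fma Var.

Arguments Atom {Var} X.
Arguments Unit {Var}.
Arguments Tensor {Var} A B.

(* [None] is the empty stoup. *)
Definition stoup (Var : Type) : Type := option (fma Var).

Definition cxt (Var : Type) : Type := list (fma Var).

(* An irreducible stoup is empty or an atom, so it is given by an optional
   element of [Var]; [stoup_of] is the inclusion into all stoups. *)
Definition irr_stoup (Var : Type) : Type := option Var.

Definition stoup_of {Var : Type} (T : irr_stoup Var) : stoup Var :=
  option_map Atom T.

(* Derivations are data, hence these families live in [Type]. *)
Inductive seqcalc {Var : Type} : stoup Var -> cxt Var -> fma Var -> Type :=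
| sc_ax : forall A,
    seqcalc (Some A) [] A
| sc_pass : forall A Gamma C,
    seqcalc (Some A) Gamma C ->
    seqcalc None (A :: Gamma) C
| sc_scut : forall S Gamma Delta A C,
    seqcalc S Gamma A ->
    seqcalc (Some A) Delta C ->
    seqcalc S (Gamma ++ Delta) C
| sc_ccut : forall S Gamma Delta0 Delta1 A C,
    seqcalc None Gamma A ->
    seqcalc S (Delta0 ++ A :: Delta1) C ->
    seqcalc S (Delta0 ++ Gamma ++ Delta1) C
| sc_IL : forall Gamma C,
    seqcalc None Gamma C ->
    seqcalc (Some Unit) Gamma C
| sc_IR :
    seqcalc None [] Unit
| sc_tensorL : forall A B Gamma C,
    seqcalc (Some A) (B :: Gamma) C ->
    seqcalc (Some (Tensor A B)) Gamma C
| sc_tensorR : forall S Gamma Delta A B,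
    seqcalc S Gamma A ->
    seqcalc None Delta B ->
    seqcalc S (Gamma ++ Delta) (Tensor A B).

Inductive focL {Var : Type} : stoup Var -> cxt Var -> fma Var -> Type :=
| foc_pass : forall A Gamma C,
    focL (Some A) Gamma C ->
    focL None (A :: Gamma) C
| foc_switch : forall (T : irr_stoup Var) Gamma C,
    focR T Gamma C ->
    focL (stoup_of T) Gamma C
| foc_IL : forall Gamma C,
    focL None Gamma C ->
    focL (Some Unit) Gamma C
| foc_tensorL : forall A B Gamma C,
    focL (Some A) (B :: Gamma) C ->
    focL (Some (Tensor A B)) Gamma C
with focR {Var : Type} : irr_stoup Var -> cxt Var -> fma Var -> Type :=
| foc_ax : forall X : Var,
    focR (Some X) [] (Atom X)
| foc_IR :
    focR None [] Unit
| foc_tensorR : forall (T : irr_stoup Var) Gamma Delta A B,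
    focR T Gamma A ->
    focL None Delta B ->
    focR T (Gamma ++ Delta) (Tensor A B).

(* Main.v *)
(** Both cuts are admissible in the focused calculus, by induction on the cut
    formula.  For a stoup cut, induct on the left premise: its left rules
    permute below the cut, and once it ends in a right phase the other premise
    can be inverted, which reduces the cut to cuts on immediate subformulae.
    For a context cut, induct on the right premise: the only principal case is
    a [pass] moving the cut formula to the stoup, where the context cut turns
    into a stoup cut on the same formula. *)

From Stdlib Require Import List.
Import ListNotations.
Require Import Defs.

Scheme focL_mutrect := Minimality for focL Sort Type
  with focR_mutrect := Minimality for focR Sort Type.
Combined Scheme focLR_mutrect from focL_mutrect, focR_mutrect.

(* [app_eq_app] only gives a [Prop]-valued existential, which cannot be
   eliminated to build a derivation. *)
Lemma app_eq_elt {T : Type} (x : T) (l1 l2 r1 r2 : list T) :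
  l1 ++ l2 = r1 ++ x :: r2 ->
  {m | l1 = r1 ++ x :: m /\ r2 = m ++ l2} +
  {m | l2 = m ++ x :: r2 /\ r1 = l1 ++ m}.
Proof.
  revert r1; induction l1 as [|y l1 IH]; intros [|z r1] E; simpl in E.
  - right; exists []; auto.
  - right; exists (z :: r1); auto.
  - injection E as -> <-. left; exists l1; auto.
  - injection E as -> E.
    destruct (IH _ E) as [[m [-> ->]]|[m [-> ->]]]; [left|right]; exists m; auto.
Qed.

(** [foc_switch] only concludes with an irreducible stoup, so a stoup [Unit] can only come from
    [foc_IL]. *)
Lemma focL_Unit_inv {Var : Type} (Gamma : cxt Var) (C : fma Var) :
  focL (Some Unit) Gamma C -> focL None Gamma C.
Proof.
  intros d; inversion d as [|[X|] ? ? ? E| |]; subst; try discriminate; assumption.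
Qed.

Lemma focL_Tensor_inv {Var : Type} (A B : fma Var) (Gamma : cxt Var) (C : fma Var) :
  focL (Some (Tensor A B)) Gamma C -> focL (Some A) (B :: Gamma) C.
Proof.
  intros d; inversion d as [|[X|] ? ? ? E| |]; subst; try discriminate; assumption.
Qed.

(** The left rules ending the first premise are replayed below, and [foc_tensorR] is inserted just
    above its [foc_switch]. *)
Lemma focL_tensorR {Var : Type} (S : stoup Var) (Gamma Delta : cxt Var) (A B : fma Var) :
  focL S Gamma A -> focL None Delta B -> focL S (Gamma ++ Delta) (Tensor A B).
Proof.
  intros d e; induction d; simpl.
  - now apply foc_pass.
  - now apply foc_switch, foc_tensorR.
  - now apply foc_IL.
  - now apply foc_tensorL.
Qed.

Lemma focL_ax {Var : Type} (A : fma Var) : focL (Some A) [] A.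
Proof.
  induction A as [X| |A IHA B IHB].
  - exact (foc_switch (foc_ax X)).
  - exact (foc_IL (foc_switch foc_IR)).
  - apply foc_tensorL, (focL_tensorR _ [] _ _ _ IHA (foc_pass IHB)).
Qed.

Definition scut_admissible {Var : Type} (A : fma Var) : Type :=
  forall S Gamma Delta C,
    focL S Gamma A -> focL (Some A) Delta C -> focL S (Gamma ++ Delta) C.

Definition ccut_admissible {Var : Type} (A : fma Var) : Type :=
  forall S Gamma Delta0 Delta1 C,
    focL None Gamma A -> focL S (Delta0 ++ A :: Delta1) C ->
    focL S (Delta0 ++ Gamma ++ Delta1) C.

Lemma scut_of_focR {Var : Type} (A : fma Var) :
  (forall T Gamma Delta C,
     focR T Gamma A -> focL (Some A) Delta C ->
     focL (stoup_of T) (Gamma ++ Delta) C) ->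
  scut_admissible A.
Proof.
  intros H S Gamma Delta C d e; induction d; simpl.
  - apply foc_pass; auto.
  - eapply H; eassumption.
  - apply foc_IL; auto.
  - apply foc_tensorL; apply IHd; auto.
Qed.

Lemma ccut_of_scut {Var : Type} (A : fma Var) :
  scut_admissible A -> ccut_admissible A.
Proof.
  intros scut S Gamma Delta0 Delta1 C d e.
  (* Both phases are treated together, and the context is tied to the cut position by an equation so
     that the position may vary in the induction. *)
  enough (H :
    (forall S Delta C, focL S Delta C -> forall Delta0 Delta1,
       Delta = Delta0 ++ A :: Delta1 -> focL S (Delta0 ++ Gamma ++ Delta1) C) *
    (forall T Delta C, focR T Delta C -> forall Delta0 Delta1,
       Delta = Delta0 ++ A :: Delta1 -> focR T (Delta0 ++ Gamma ++ Delta1) C))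
    by exact (fst H _ _ _ e _ _ eq_refl).
  clear S Delta0 Delta1 C e.
  apply focLR_mutrect.
  - intros B Delta C e IH [|B' Delta0] Delta1 E; injection E as -> ->.
    + exact (scut _ _ _ _ d e).
    + apply foc_pass, IH; reflexivity.
  - intros; apply foc_switch; auto.
  - intros; apply foc_IL; auto.
  - intros B B' Delta C _ IH Delta0 Delta1 ->.
    apply foc_tensorL, (IH (B' :: Delta0)); reflexivity.
  - intros X Delta0 Delta1 E; destruct Delta0; discriminate.
  - intros Delta0 Delta1 E; destruct Delta0; discriminate.
  - intros T Delta Delta' B B' e IH e' IH' Delta0 Delta1 E.
    (* The cut formula lies in the context of exactly one premise of [foc_tensorR]. *)
    destruct (app_eq_elt _ _ _ _ _ E) as [[m [-> ->]]|[m [-> ->]]].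
    + rewrite 2!app_assoc, <- (app_assoc Delta0).
      apply foc_tensorR; auto.
    + rewrite <- app_assoc; apply foc_tensorR; auto.
Qed.

Lemma focL_scut {Var : Type} (A : fma Var) : scut_admissible A.
Proof.
  induction A as [X| |A IHA B IHB]; apply scut_of_focR;
    intros T Gamma Delta C d e; inversion d; subst; simpl.
  - exact e.
  - apply focL_Unit_inv, e.
  (* Inverting [e] puts [A] in the stoup and [B] at the head of the context, whence the empty
     [Delta0]: [B] is cut first, then [A]. *)
  - rewrite <- app_assoc. eapply IHA; [apply foc_switch; eassumption|].
    eapply (ccut_of_scut _ IHB) with (Delta0 := []); [eassumption|].
    apply focL_Tensor_inv, e.
Qed.

Theorem theorem5p2 (Var : Type) (S : stoup Var) (Gamma : cxt Var) (C : fma Var) :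
  seqcalc S Gamma C -> focL S Gamma C.
Proof.
  induction 1.
  - apply focL_ax.
  - now apply foc_pass.
  - eapply focL_scut; eassumption.
  - eapply ccut_of_scut; [apply focL_scut|eassumption|assumption].
  - now apply foc_IL.
  - exact (foc_switch foc_IR).
  - now apply foc_tensorL.
  - now apply focL_tensorR.
Qed.
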